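(* Let $k$ be an odd integer that is not a prime power. Then there exist $m \ge 1$ and an induced subgraph $H$ of the torus $C_k^m$ such that $|V(H)|$ divides $k^m$, but there is no $n$ for which $C_k^n$ admits a perfect $H$-packing.
   Context: For integers $k \ge 3$ and $n \ge 1$, the torus $C_k^n$ (the $n$-th Cartesian power of the cycle $C_k$) is the graph with vertex set $\{0,\ldots,k-1\}^n$ in which two vertices $u$ and $v$ are adjacent if and only if they differ in exactly one coordinate $i$, and there $u_i - v_i \equiv \pm 1 \pmod k$. For graphs $G$ and $H$, an $H$-packing of $G$ is a collection of vertex-disjoint subgraphs of $G$ each isomorphic to $H$ (not necessarily induced); it is perfect if every vertex of $G$ lies in one of its members. *)

(* Defs.v *)
From mathcomp Require Import all_boot.
Set Implicit Arguments.
Unset Strict Implicit.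
Unset Printing Implicit Defensive.

(* Finite simple graphs; the graph coerces to its finite type of vertices. *)
Record sgraph := SGraph {
  vertex :> finType;
  adj : rel vertex;
  adj_sym : symmetric adj;
  adj_irrefl : irreflexive adj }.

Definition isomorphic (G H : sgraph) : Prop :=
  exists2 f : G -> H, bijective f & forall x y : G, adj (f x) (f y) = adj x y.

(* Subgraphs are not assumed to be induced. *)
Record subgraph (G : sgraph) := Subgraph {
  verts : {set G};
  sub_adj : rel G;
  sub_adj_sym : symmetric sub_adj;
  sub_adj_incl : forall x y : G,
    sub_adj x y -> [/\ x \in verts, y \in verts & adj x y] }.

Definition induced (G : sgraph) (A : subgraph G) : Prop :=
  forall x y : G, x \in verts A -> y \in verts A -> sub_adj A x y = adj x y.

Section GraphOfSubgraph.
Variables (G : sgraph) (A : subgraph G).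

Definition sub_rel : rel {x : G | x \in verts A} :=
  fun x y => sub_adj A (val x) (val y).

Lemma sub_rel_sym : symmetric sub_rel.
Proof. by move=> x y; apply: sub_adj_sym. Qed.

Lemma sub_rel_irrefl : irreflexive sub_rel.
Proof.
move=> x; apply/negP => /sub_adj_incl [_ _].
by rewrite adj_irrefl.
Qed.

Definition graph_of_subgraph : sgraph := SGraph sub_rel_sym sub_rel_irrefl.
End GraphOfSubgraph.

Coercion graph_of_subgraph : subgraph >-> sgraph.

(* A collection of subgraphs is given as a finite indexed family; when H is
   nonempty, disjointness makes the members pairwise distinct. *)
Definition packing (H G : sgraph) (I : finType) (F : I -> subgraph G) : Prop :=
  (forall i : I, isomorphic (F i) H) /\
  (forall i j : I, i != j -> [disjoint verts (F i) & verts (F j)]).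

Definition perfect_packing (H G : sgraph) (I : finType) (F : I -> subgraph G) :
    Prop :=
  packing H F /\ (forall x : G, exists i : I, x \in verts (F i)).

Definition has_perfect_packing (H G : sgraph) : Prop :=
  exists (I : finType) (F : I -> subgraph G), perfect_packing H F.

Section Torus.
Variables k n : nat.

(* The congruence u_i - v_i = +1 or -1 modulo k is written without
   subtraction, which is truncated on nat. *)
Definition torus_adj : rel {ffun 'I_n -> 'I_k} := fun u v =>
  [exists i : 'I_n,
    [&& u i != v i,
        [forall j : 'I_n, (j != i) ==> (u j == v j)] &
        (u i == v i + 1 %[mod k]) || (v i == u i + 1 %[mod k])]].

Lemma torus_adj_sym : symmetric torus_adj.
Proof.
move=> u v; apply: eq_existsb => i; rewrite eq_sym orbC.
by congr [&& _, _ & _]; apply: eq_forallb => j; rewrite [u j == _]eq_sym.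
Qed.

Lemma torus_adj_irrefl : irreflexive torus_adj.
Proof. by move=> u; apply/existsP => -[i]; rewrite eqxx. Qed.

Definition torus : sgraph := SGraph torus_adj_sym torus_adj_irrefl.
End Torus.

Definition prime_power (k : nat) : Prop :=
  exists p e : nat, [/\ prime p, 0 < e & k = p ^ e].

(* Main.v *)
(** Write k = a b with 1 < a < b coprime, and let S be the set of the b^n points
    of the torus all of whose coordinates are divisible by a.  It suffices to
    find H such that every copy of H in the torus meets S in a multiple of a
    points: a perfect packing would then force a to divide b^n.

    H lies in a coordinate plane.  It is a Young diagram containing both axes,
    made of a b square blocks of side a, so each of the a^2 residue classes
    modulo a of the plane contains exactly a b points of H; three dimensions are
    used only to make |H| = a^3 b divide k^3.  Since k is odd, a closed walk of
    length k winds straight around one coordinate direction, so the axes of a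
    copy of H are straight; completing squares, the whole copy is the image of H
    under an affine map with steps along two coordinate directions.  It therefore meets S in no point or in the image of one residue
    class. *)
Require Import Defs.
From mathcomp Require Import all_boot all_algebra.
From mathcomp Require Import zify.
Set Implicit Arguments.
Unset Strict Implicit.
Unset Printing Implicit Defensive.
Import GRing.Theory.

(** * Rigidity of Young diagrams mapped into the torus *)

Section Rigidity.
Local Open Scope ring_scope.
Variables K n : nat.
Local Notation k := K.+2.
Local Notation V := {ffun 'I_n -> 'I_k}.
Implicit Types (u v p : V) (d : 'I_n * bool).

(** A direction pairs a coordinate with a sign, [true] standing for -1. Writing [k] as [K.+2] gives
    ['I_k] the ring structure of the integers modulo [k]. *)
Definition step d : V := [ffun l => if l == d.1 then (-1) ^+ d.2 else 0].

Lemma Zp_sign_neq0 (s : bool) : ((-1) ^+ s : 'I_k) != 0.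
Proof. by case: s; rewrite ?oppr_eq0 oner_eq0. Qed.

Lemma ord_addr1E (x y : 'I_k) : (y == x + 1 %[mod k])%N = (y == x + 1).
Proof. by rewrite -val_eqE /= modnDmr modn_small. Qed.

Lemma torus_adjE u v : torus_adj u v = [exists d, v == u + step d].
Proof.
apply/existsP/existsP => [[i /and3P[_ /forallP uv /orP[]]]|[[i s] /eqP->]].
- rewrite ord_addr1E => /eqP Eu; exists (i, true); apply/eqP/ffunP => l.
  rewrite !ffunE /=; case: eqP => [->|/eqP li]; first by rewrite Eu addrK.
  by have:= uv l; rewrite li addr0 /= => /eqP.
- rewrite ord_addr1E => /eqP Ev; exists (i, false); apply/eqP/ffunP => l.
  rewrite !ffunE /=; case: eqP => [->|/eqP li]; first by rewrite Ev.
  by have:= uv l; rewrite li addr0 /= => /eqP.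
- exists i; rewrite !ord_addr1E !ffunE eqxx /=; apply/and3P; split.
  + by rewrite -subr_eq0 opprD addNKr oppr_eq0 Zp_sign_neq0.
  + by apply/forallP => j; apply/implyP => /negPf ji; rewrite !ffunE ji addr0.
  + by case: s; rewrite ?subrK ?eqxx ?orbT.
Qed.

Lemma torus_adjP u v : reflect (exists d, v = u + step d) (torus_adj u v).
Proof.
by rewrite torus_adjE; apply: (iffP existsP) => -[d /eqP ?]; exists d.
Qed.

(* Among the k steps some coordinate i is used unequally often in its two
   directions, as k is odd; the two counts agree modulo k and add up to at most
   k, so one of them is k. *)
Lemma closed_walk_straight (w : nat -> V) :
    odd k -> w k = w 0%N ->
    (forall x, x < k -> torus_adj (w x) (w x.+1))%N ->
  exists d, forall x, (x <= k)%N -> w x = w 0%N + step d *+ x.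
Proof.
move=> k_odd wk w_adj.
have /fin_all_exists[d wd] (x : 'I_k) : exists d, w x.+1 = w x + step d.
  by apply/torus_adjP/w_adj.
pose c e := #|[set x | d x == e]|.
have sum0 : \sum_(x < k) step (d x) = 0.
  rewrite -[RHS](subrr (w 0%N)) -{1}wk -telescope_sumr // big_mkord.
  by apply: eq_bigr => x _; rewrite wd addrC addKr.
(* Coordinate [i] of the total displacement, which is zero, is the difference of the two counts. *)
have ceq i : c (i, false) = c (i, true) %[mod k].
  have /ffunP/(_ i) := sum0; rewrite sum_ffunE ffunE => /eqP.
  have -> : \sum_(x < k) step (d x) i = (c (i, false))%:R - (c (i, true))%:R.
    have cR s : (c (i, s))%:R = \sum_(x < k) (d x == (i, s))%:R :> 'I_k.
      by rewrite -natr_sum /c -sum1dep_card big_mkcond.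
    rewrite !cR -sumrB; apply: eq_bigr => x _; rewrite ffunE.
    case: (d x) => j s /=; rewrite -!pair_eqE /= [i == j]eq_sym.
    by case: (j == i); case: s; rewrite ?subr0 ?sub0r.
  by rewrite subr_eq0 !Zp_nat => /eqP /(congr1 val).
have csum : (\sum_i (c (i, false) + c (i, true)) = k)%N.
  rewrite -[RHS]card_ord -sum1_card.
  rewrite (partition_big (fun x => (d x).1) xpredT) //=.
  apply: eq_bigr => i _; rewrite (bigID (fun x => (d x).2)) /= addnC.
  rewrite /c -!sum1dep_card; congr (_ + _)%N; apply: eq_bigl => x.
    by case: (d x) => j [] /=; rewrite -pair_eqE /= ?andbT ?andbF.
  by case: (d x) => j [] /=; rewrite -pair_eqE /= ?andbT ?andbF.
have [i ci] : exists i, c (i, false) != c (i, true).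
  apply/existsP; apply: contraLR k_odd; rewrite negb_exists => /forallP cc.
  rewrite -csum (eq_bigr (fun i => c (i, true) * 2)%N); last first.
    by move=> i _; rewrite (eqP (negbNE (cc i))) addnn muln2.
  by rewrite -big_distrl /= muln2 odd_double.
have cle : (c (i, false) + c (i, true) <= k)%N.
  by rewrite -csum (bigD1 i) //= leq_addr.
have [s cs] : exists s, c (i, s) = k.
  have ltk e : (c e < k)%N || (c e == k).
    by rewrite orbC -leq_eqVlt -[X in (_ <= X)%N]card_ord max_card.
  move: (ltk (i, false)) (ltk (i, true)) => /orP[l1|/eqP ?]; last by exists false.
  move=> /orP[l2|/eqP ?]; last by exists true.
  by move: (ceq i) ci; rewrite !modn_small // => ->; rewrite eqxx.
have dE x : d x = (i, s).
  have /eqP/setP/(_ x) : [set x | d x == (i, s)] == setT.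
    by rewrite eqEcard subsetT cardsT card_ord -/(c _) cs leqnn.
  by rewrite !inE => /eqP.
exists (i, s); elim=> [|x IHx] xk; first by rewrite addr0.
by have:= wd (Ordinal xk); rewrite dE /= => ->; rewrite IHx ?(ltnW xk) // mulrSr addrA.
Qed.

(** The path through [p + step d] continues by some [f], the other by some [g], and
    [step d + step f = step e + step g]. Comparing coordinates [d.1] and [e.1], either [f] undoes
    [d], so that [q = p], or [g] is the same step as [d]. *)
Lemma square_completion p q d e :
    d.1 != e.1 -> torus_adj (p + step d) q -> torus_adj (p + step e) q ->
  q != p -> q = p + step d + step e.
Proof.
move=> de /torus_adjP[f qf] /torus_adjP[g qg] qp.
have Ef : step d + step f = step e + step g.
  by apply: (addrI p); rewrite !addrA -qf -qg.
case: d e f g => [i s] [j t] [l r] [m o] /= in de qf qg Ef *.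
have := congr1 (fun h : V => h i) Ef; have := congr1 (fun h : V => h j) Ef.
rewrite !ffunE /= !eqxx (negPf de) [j == i]eq_sym (negPf de) !add0r.
have [Eil|il] := eqVneq i l.
  subst l; rewrite [j == i]eq_sym (negPf de).
  have [Ejm|jm] := eqVneq j m; last first.
    by move/eqP; rewrite addr0 eq_sym (negPf (Zp_sign_neq0 _)).
  subst m; rewrite (negPf de) => _ E0.
  case/eqP: qp; rewrite qf -addrA -[RHS]addr0; congr (_ + _).
  apply/ffunP => x; rewrite !ffunE /=; case: (x == i) => //.
  by rewrite addr0.
rewrite addr0.
have [Eim|im] := eqVneq i m; last by move=> _ /eqP; rewrite (negPf (Zp_sign_neq0 _)).
subst m => _ E.
suff Eg : step (i, o) = step (i, s).
  by rewrite qg Eg addrAC.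
by apply/ffunP => x; rewrite !ffunE /= E.
Qed.

(* Any cell off the axes completes a square with three cells that are closer to
   the origin. *)
Lemma young_rigid (P : nat -> nat -> bool) (G : nat -> nat -> V) :
    odd k ->
    (forall x y x' y', x' <= x -> y' <= y -> P x y -> P x' y')%N ->
    (forall x, x < k -> P x 0 /\ P 0 x)%N ->
    G k 0%N = G 0%N 0%N -> G 0%N k = G 0%N 0%N ->
    (forall x, x < k -> torus_adj (G x 0%N) (G x.+1 0%N))%N ->
    (forall y, y < k -> torus_adj (G 0%N y) (G 0%N y.+1))%N ->
    (forall x y, x.+1 < k -> y < k -> P x.+1 y ->
       torus_adj (G x y) (G x.+1 y))%N ->
    (forall x y, x < k -> y.+1 < k -> P x y.+1 ->
       torus_adj (G x y) (G x y.+1))%N ->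
    (forall x y x' y', x < k -> y < k -> x' < k -> y' < k ->
       P x y -> P x' y' -> G x y = G x' y' -> x = x' /\ y = y')%N ->
  exists d e, d.1 != e.1 /\ forall x y, (x < k)%N -> (y < k)%N -> P x y ->
    G x y = G 0%N 0%N + step d *+ x + step e *+ y.
Proof.
move=> k_odd Pdown Paxes Gk0 G0k Gx Gy Ghor Gver Ginj.
have [d /= Gd] := closed_walk_straight (w := G^~ 0%N) k_odd Gk0 Gx.
have [e Ge] := closed_walk_straight (w := G 0%N) k_odd G0k Gy.
have lt1k : (1 < k)%N by [].
(* Axes along the same coordinate would collide: [G 1 0 = G 0 1] for equal signs, and
   [G K.+1 0 = G 0 1] for opposite signs, since [k] steps along [d] sum to zero. *)
have de : d.1 != e.1.
  apply/negP => /eqP.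
  case: d e Gd Ge => [i s] [j t] Gd Ge /= ij; subst j.
  have [st|st] := eqVneq t s.
    subst t.
    have [] // := Ginj 1%N 0%N 0%N 1%N _ _ _ _ (Paxes 1%N lt1k).1 (Paxes 1%N lt1k).2.
    by rewrite (Gd 1%N) // (Ge 1%N).
  have [] // := Ginj K.+1 0%N 0%N 1%N _ _ _ _ (Paxes K.+1 (ltnSn _)).1 (Paxes 1%N lt1k).2.
  rewrite (Gd K.+1) // (Ge 1%N) // mulr1n; congr (_ + _).
  have /(congr1 (fun v => v - step (i, s))) := Gd k (leqnn _).
  rewrite /= Gk0 mulrSr addrA addrK => /addrI <-.
  apply/ffunP => l; rewrite !ffunE /=; case: (l == i); rewrite ?oppr0 //.
  by move: st; case: s {Gd}; case: t {Ge} => // _; rewrite opprK.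
exists d, e; split=> // x y.
have [m] := ubnP (x + y); elim: m x y => // m IHm [|x] [|y] xym xk yk Pxy.
- by rewrite !addr0.
- by rewrite addr0 (Ge y.+1) // ltnW.
- by rewrite addr0 (Gd x.+1) // ltnW.
have [xk' yk'] := (ltnW xk, ltnW yk).
have Pd := Pdown _ _ _ _ _ _ Pxy.
have E00 : G x y = G 0%N 0%N + step d *+ x + step e *+ y.
  by apply: IHm; rewrite ?Pd //; lia.
have E10 : G x.+1 y = G x y + step d.
  rewrite (IHm x.+1 y) ?Pd //; last lia.
  by rewrite E00 mulrSr addrA [RHS]addrAC.
have E01 : G x y.+1 = G x y + step e.
  rewrite (IHm x y.+1) ?Pd //.
  by rewrite E00 mulrSr addrA.
rewrite (@square_completion (G x y) (G x.+1 y.+1) d e) //.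
- by rewrite E00 !mulrSr !addrA; congr (_ + _); apply: addrAC.
- by rewrite -E10; apply: Gver.
- by rewrite -E01; apply: Ghor.
apply/eqP => E; have Pxy' := Pd _ _ (leqnSn x) (leqnSn y).
by have [] := Ginj _ _ _ _ xk yk xk' yk' Pxy Pxy' E; lia.
Qed.
End Rigidity.

(** * The Young diagram and its cell counts *)

Definition width (a b v : nat) : nat :=
  if (v < a.-1) then b else if v == a.-1 then a else 1.

(* A Young diagram with a * b cells containing both axes of the b x b square,
   with every cell blown up to an a x a square. *)
Definition shape (a b x y : nat) : bool := (x %/ a < width a b (y %/ a)).

Section Shape.
Variables a b : nat.
Hypotheses (a_gt1 : 1 < a) (lt_ab : a < b).

Lemma width_le v : width a b v <= b.
Proof. by rewrite /width; do 2?case: ifP => _ //; lia. Qed.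

(** The successive widths [b], [a], 1 decrease, since [1 < a < b]. *)
Lemma shape_down x y x' y' : x' <= x -> y' <= y -> shape a b x y -> shape a b x' y'.
Proof.
move=> xx yy xy; apply: leq_trans (leq_ltn_trans (leq_div2r a xx) xy) _.
move: (leq_div2r a yy); rewrite /width.
by do 4?case: ifP => ? //; lia.
Qed.

(** The widths are chosen for this total: [(a - 1) * b + a + (b - a) = a * b]. *)
Lemma sum_width : \sum_(u < b) \sum_(v < b) (u < width a b v : nat) = a * b.
Proof.
rewrite exchange_big /= (eq_bigr (fun v : 'I_b => width a b v)); last first.
  move=> v _; rewrite -(big_mkcond (fun u : 'I_b => u < width a b v) (fun=> 1)).
  by rewrite -(big_ord_widen b (fun=> 1)) ?width_le // sum1_card card_ord.
rewrite -(big_mkord xpredT) (big_cat_nat _ (n := a.-1)) //=; last lia.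
rewrite (big_cat_nat _ (n := a) (m := a.-1)) //=; try lia.
rewrite -{4}(prednK (ltnW a_gt1)) big_nat1.
rewrite (eq_big_nat _ _ (F2 := fun=> b)); last by move=> v /andP[_ va]; rewrite /width va.
rewrite (eq_big_nat _ _ (m := a) (F2 := fun=> 1)); last first.
  by move=> v av; rewrite /width !ifF //; lia.
rewrite !sum_nat_const_nat /width ltnn eqxx.
nia.
Qed.

Variable n : nat.
Hypothesis nab : n = a * b.

(** Euclidean division by [a] splits an index into a block number and a residue, which then range
    independently. *)
Lemma sum_divmod (F : nat -> nat -> nat) :
  \sum_(x < n) F (x %/ a) (x %% a) = \sum_(u < b) \sum_(r < a) F u r.
Proof.
rewrite nab mulnC -(big_mkord xpredT (fun x => F (x %/ a) (x %% a))).
rewrite big_nat_mul big_mkord; apply: eq_bigr => u _.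
rewrite -{1}[u * a]add0n big_addn mulSn addnK big_mkord.
apply: eq_bigr => r _; rewrite addnC divnMDl ?(ltnW a_gt1) // modnMDl.
by rewrite divn_small // modn_small // addn0.
Qed.

Lemma card_pairs (P : nat -> nat -> bool) :
  #|[set z : 'I_n * 'I_n | P z.1 z.2]| = \sum_(x < n) \sum_(y < n) P x y.
Proof. by rewrite -sum1dep_card big_mkcond pair_big. Qed.

Lemma card_dvdn : #|[set x : 'I_n | a %| x]| = b.
Proof.
rewrite -sum1dep_card big_mkcond (sum_divmod (fun _ r => r == 0)) /=.
rewrite (eq_bigr (fun=> 1)) => [|u _]; first by rewrite sum_nat_const card_ord muln1.
rewrite (bigD1 (Ordinal (ltnW a_gt1))) //= big1 // => r.
by rewrite -val_eqE /= => /negPf ->.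
Qed.

Lemma shape_axes x : x < n -> shape a b x 0 /\ shape a b 0 x.
Proof.
rewrite /shape !div0n /width => xn; split.
  by rewrite -subn1 subn_gt0 a_gt1 ltn_divLR 1?mulnC -?nab // ltnW.
by do 2?case: ifP => _ //; lia.
Qed.

(** Each block of side [a] has exactly one cell in the given residue class, so the count is the
    number of blocks, given by [sum_width]. *)
Lemma card_shape_class c c' : c < a -> c' < a ->
  #|[set z : 'I_n * 'I_n |
      [&& shape a b z.1 z.2, z.1 %% a == c & z.2 %% a == c']]| = a * b.
Proof.
move=> ca c'a.
rewrite (card_pairs (fun x y => [&& shape a b x y, x %% a == c & y %% a == c'])).
rewrite (sum_divmod (fun u r => \sum_(y < n)
  [&& u < width a b (y %/ a), r == c & y %% a == c'])).
rewrite -sum_width; apply: eq_bigr => u _.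
rewrite (bigD1 (Ordinal ca)) //= [X in _ + X]big1 ?addn0; last first.
  move=> r rc; apply: big1 => y _.
  by rewrite -val_eqE /= in rc; rewrite (negPf rc) andbF.
rewrite (sum_divmod (fun v r => [&& u < width a b v, c == c & r == c'])).
apply: eq_bigr => v _; rewrite (bigD1 (Ordinal c'a)) //= !eqxx !andbT.
rewrite big1 ?addn0 // => r rc.
by rewrite -val_eqE /= in rc; rewrite (negPf rc) !andbF.
Qed.

Lemma card_shape : #|[set z : 'I_n * 'I_n | shape a b z.1 z.2]| = a ^ 3 * b.
Proof.
have a_gt0 := ltnW a_gt1.
rewrite -sum1_card (partition_big (fun z : 'I_n * 'I_n =>
  (Ordinal (ltn_pmod z.1 a_gt0), Ordinal (ltn_pmod z.2 a_gt0))) xpredT) //=.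
rewrite (eq_bigr (fun=> a * b)) => [|[c c'] _].
  by rewrite sum_nat_const card_prod card_ord; lia.
rewrite sum1dep_card -(card_shape_class (ltn_ord c) (ltn_ord c')).
by apply: eq_card => z; rewrite !inE.
Qed.
End Shape.

(** * Copies of the diagram meet the sublattice in a multiple of [a] points *)

Section Copies.
Local Open Scope ring_scope.
Variables (K a b n : nat).
Local Notation k := K.+2.
Local Notation V := {ffun 'I_n -> 'I_k}.
Hypotheses (a_gt1 : (1 < a)%N) (lt_ab : (a < b)%N) (kab : k = (a * b)%N).

(** The default value of [nth] supplies the third coordinate, 0. *)
Definition plane_pt (z : 'I_k * 'I_k) : {ffun 'I_3 -> 'I_k} :=
  [ffun l : 'I_3 => nth 0 [:: z.1; z.2] l].

Definition young : {set 'I_k * 'I_k} :=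
  [set z : 'I_k * 'I_k | shape a b z.1 z.2].

Definition sublattice : {set V} := [set v : V | [forall l, (a %| v l)%N]].

Lemma plane_pt_inj : injective plane_pt.
Proof.
move=> [x y] [x' y'] /ffunP E; have:= E 0; have:= E 1.
by rewrite !ffunE /= => -> ->.
Qed.

Lemma card_sublattice : #|sublattice| = (b ^ n)%N.
Proof.
rewrite -[X in (X ^ _)%N](card_dvdn a_gt1 kab) -[X in (_ ^ X)%N]card_ord -card_ffun_on.
apply: eq_card => v; rewrite !inE.
by apply/forallP/forallP => H l; have:= H l; rewrite !inE.
Qed.

(** Since [a] divides [k], residues modulo [a] make sense in ['I_k], and a unit step either way runs
    through them cyclically. *)
Lemma dvdn_ord_line (p : 'I_k) (s : bool) : exists2 c, (c < a)%N &
  forall x : nat, (a %| (p + (-1) ^+ s *+ x : 'I_k)%R)%N = (x %% a == c)%N.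
Proof.
have ak : (a %| k)%N by rewrite kab dvdn_mulr.
have dvdD (u v : 'I_k) : (a %| (u + v)%R)%N = (a %| u + v)%N.
  by rewrite /dvdn /= modn_dvdm.
have dvdN (u : 'I_k) : (a %| (- u)%R)%N = (a %| u)%N.
  have := dvdD u (- u); rewrite subrr dvdn0 => /esym uN.
  by apply/idP/idP => h; move: uN; [rewrite (dvdn_addl _ h) | rewrite (dvdn_addr _ h)].
have minus (q : 'I_k) (x : nat) : (a %| (q - x%:R)%R)%N = (x %% a == q %% a)%N.
  have xa : ((x%:R : 'I_k) %% a = x %% a)%N by rewrite Zp_nat /= modn_dvdm.
  have -> : (q %% a = ((q - x%:R)%R + x) %% a)%N.
    by rewrite -{1}(subrK x%:R q) /= modn_dvdm // -modnDmr xa modnDmr.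
  by rewrite -[X in (X %% _ == _)%N]add0n eq_sym eqn_modDr mod0n.
(* The point [p - x] is divisible by [a] when [x] is congruent to [p], and [p + x] when [x] is
   congruent to [-p]. *)
case: s; [exists (p %% a)%N | exists ((- p)%R %% a)%N];
  rewrite ?ltn_pmod ?(ltnW a_gt1) // => x.
- by rewrite expr1 mulNrn minus.
- by rewrite -minus -dvdN opprD.
Qed.

(** By [young_rigid], only two coordinates vary on the copy, one with [z.1] and one with [z.2].
    Divisibility by [a] there selects one residue class of cells; the other coordinates are constant
    and admit all of this class or nothing. *)
Lemma dvdn_card_copy (phi : 'I_k * 'I_k -> V) :
    odd k -> {in young &, injective phi} ->
    {in young &, forall z z', torus_adj (plane_pt z) (plane_pt z') ->
                              torus_adj (phi z) (phi z')} ->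
  (a %| #|(phi @: young) :&: sublattice|)%N.
Proof.
move=> k_odd phi_inj phi_adj.
(* Reducing indices modulo [k] makes both axes closed walks of length [k], as [young_rigid]
   requires. *)
pose G x y := phi (inZp x, inZp y).
have inZpS x : inZp x.+1 = inZp x + 1 :> 'I_k.
  by rewrite -!Zp_nat -natr1.
have hor (x y : nat) :
    torus_adj (plane_pt (inZp x, inZp y)) (plane_pt (inZp x.+1, inZp y)).
  apply/torus_adjP; exists (0, false); apply/ffunP => l; rewrite !ffunE /= inZpS.
  by case: l => [[|[|[]]] //] /=; rewrite ?addr0.
have ver (x y : nat) :
    torus_adj (plane_pt (inZp x, inZp y)) (plane_pt (inZp x, inZp y.+1)).
  apply/torus_adjP; exists (1, false); apply/ffunP => l; rewrite !ffunE /= inZpS.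
  by case: l => [[|[|[]]] //] /=; rewrite ?addr0.
have youngE (x y : nat) : (x < k)%N -> (y < k)%N ->
    ((inZp x, inZp y) \in young) = shape a b x y.
  by move=> xk yk; rewrite inE /= !modn_small.
have inZpk : inZp k = inZp 0 :> 'I_k by apply: val_inj; rewrite /= modnn.
have axes := shape_axes a_gt1 lt_ab kab.
have wrap x : (x < k)%N -> exists2 x', inZp x.+1 = inZp x' :> 'I_k & (x' < k)%N.
  rewrite leq_eqVlt => /orP[/eqP ->|]; last by exists x.+1.
  by exists 0%N.
have [d [e [de GE]]] : exists d e : 'I_n * bool, d.1 != e.1 /\
    forall x y, (x < k)%N -> (y < k)%N -> shape a b x y ->
      G x y = G 0%N 0%N + step K d *+ x + step K e *+ y.
  apply: (@young_rigid K n (shape a b) G k_odd (shape_down a_gt1 lt_ab) axes).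
  - by rewrite /G inZpk.
  - by rewrite /G inZpk.
  - move=> x xk; apply: phi_adj (hor _ _); first by rewrite youngE ?(axes _ xk).1.
    by have [x' -> x'k] := wrap x xk; rewrite youngE ?(axes _ x'k).1.
  - move=> x xk; apply: phi_adj (ver _ _); first by rewrite youngE ?(axes _ xk).2.
    by have [x' -> x'k] := wrap x xk; rewrite youngE ?(axes _ x'k).2.
  - move=> x y xk yk Px; apply: phi_adj (hor _ _); rewrite youngE ?(ltnW xk) //.
    exact: shape_down Px.
  - move=> x y xk yk Px; apply: phi_adj (ver _ _); rewrite youngE ?(ltnW yk) //.
    exact: shape_down Px.
  move=> x y x' y' xk yk x'k y'k Px Px' /phi_inj.
  rewrite !youngE // => /(_ Px Px') [].
  by rewrite !modn_small.
have phiE z : z \in young -> phi z = G 0%N 0%N + step K d *+ z.1 + step K e *+ z.2.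
  case: z => x y; rewrite inE /= => Pz.
  by rewrite -GE // /G !valZpK.
have -> : phi @: young :&: sublattice = phi @: [set z in young | phi z \in sublattice].
  apply/setP => v; rewrite inE; apply/andP/imsetP => [[/imsetP[z zy ->] zS]|[z]].
    by exists z; rewrite // inE zy.
  by rewrite inE => /andP[zy zS] ->; rewrite imset_f.
rewrite card_in_imset; last first.
  by move=> z z' /setIdP[zy _] /setIdP[zy' _]; apply: phi_inj.
set w := G 0%N 0%N in GE phiE *.
have coord l x y : (w + step K d *+ x + step K e *+ y) l =
    w l + (if l == d.1 then (-1) ^+ d.2 else 0) *+ x
        + (if l == e.1 then (-1) ^+ e.2 else 0) *+ y.
  by rewrite !ffunE !ffunMnE !ffunE.
have [c ca cP] := dvdn_ord_line (w d.1) d.2.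
have [c' c'a c'P] := dvdn_ord_line (w e.1) e.2.
have coord_d x y : (a %| (w + step K d *+ x + step K e *+ y)%R d.1)%N = (x %% a == c)%N.
  by rewrite coord eqxx (negPf de) mul0rn addr0 cP.
have coord_e x y : (a %| (w + step K d *+ x + step K e *+ y)%R e.1)%N = (y %% a == c')%N.
  by rewrite coord eqxx eq_sym (negPf de) mul0rn addr0 c'P.
have coord0 l x y : l != d.1 -> l != e.1 ->
    (w + step K d *+ x + step K e *+ y) l = w l.
  by move=> /negPf ld /negPf le; rewrite coord ld le !mul0rn !addr0.
(* If all constant coordinates are divisible by [a], the intersection is the image of a full residue
   class; otherwise it is empty. *)
have [/forallP base|/forallPn[l]] := boolP
    [forall l, (l != d.1) && (l != e.1) ==> (a %| w l)%N].
  have -> : [set z in young | phi z \in sublattice] =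
     [set z : 'I_k * 'I_k | [&& shape a b z.1 z.2, z.1 %% a == c & z.2 %% a == c']%N].
    apply/setP => z; rewrite [LHS]inE [RHS]inE.
    have [zy|] := boolP (z \in young); last by rewrite inE => /negPf ->.
    have -> : shape a b z.1 z.2 by move: zy; rewrite inE.
    rewrite phiE // inE !andTb -(coord_d z.1 z.2) -(coord_e z.1 z.2).
    apply/forallP/andP => [zS|[zd ze] l]; first by split; apply: zS.
    have [->//|ld] := eqVneq l d.1; have [->//|le] := eqVneq l e.1.
    by rewrite coord0 //; have := base l; rewrite ld le.
  by rewrite (card_shape_class a_gt1 lt_ab kab ca c'a) dvdn_mulr.
rewrite negb_imply => /andP[/andP[ld le] Nal].
rewrite (_ : [set z in _ | _] = set0) ?cards0 ?dvdn0 //.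
apply/setP => z; rewrite in_set0 in_set; apply/negP => /andP[zy].
by rewrite phiE // inE => /forallP/(_ l); rewrite coord0 // (negPf Nal).
Qed.

End Copies.

(** * Counting along a packing, and copies as maps *)

Definition induced_subgraph (G : sgraph) (S : {set G}) : subgraph G.
Proof.
apply: (@Subgraph G S (fun x y => [&& x \in S, y \in S & adj x y])).
- by move=> x y; rewrite adj_sym andbCA.
- by move=> x y /and3P.
Defined.

Lemma induced_subgraphP (G : sgraph) (S : {set G}) : induced (induced_subgraph S).
Proof. by move=> x y /= -> ->. Qed.

Lemma perfect_packing_dvdn (H G : sgraph) (S : {set G}) (m : nat) :
    (forall A : subgraph G, isomorphic A H -> m %| #|verts A :&: S|) ->
  has_perfect_packing H G -> (m %| #|S|).
Proof.
move=> mA [I [F [[F_iso F_disj] F_cover]]].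
(* [h] picks a member containing each vertex; by disjointness its fibres are exactly the vertex sets
   of the members. *)
have [h hP] := fin_all_exists F_cover.
rewrite -sum1_card (partition_big h xpredT) //=; apply: dvdn_sum => i _.
rewrite sum1dep_card (_ : [set _ | _] = verts (F i) :&: S); first exact/mA/F_iso.
apply/setP => x; rewrite !inE andbC; congr (_ && _).
apply/eqP/idP => [<- //|xi]; apply/eqP/contraT => /F_disj/disjointFr/(_ (hP x)).
by rewrite xi.
Qed.

(** The map is [pt] followed by the inverse isomorphism. Adjacency is carried in one direction,
    since the copy [A] may omit edges of [G']. *)
Lemma isomorphic_imset (T : finType) (G G' : sgraph) (pt : T -> G) (D : {set T})
    (A : subgraph G') (x0 : G') :
    injective pt -> isomorphic A (induced_subgraph (pt @: D)) ->
  exists phi : T -> G', [/\ phi @: D = verts A, {in D &, injective phi} &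
    {in D &, forall z z', adj (pt z) (pt z') -> adj (phi z) (phi z')}].
Proof.
move=> pt_inj [f [g fK gK] f_adj].
pose H := induced_subgraph (pt @: D).
(* [x0] is the value outside [D], where [pt z] is not a vertex of [H]. *)
pose phi z := if insub (pt z) is Some u then val (g (u : H)) else x0.
have phiE z (zD : z \in D) : phi z = val (g (Sub (pt z) (imset_f pt zD) : H)).
  by rewrite /phi (insubT (fun x => x \in pt @: D) (imset_f pt zD)).
exists phi; split.
- apply/setP => x; apply/imsetP/idP => [[z zD ->]|xA].
    by rewrite (phiE z zD); apply: valP.
  have /imsetP[z zD fz] := valP (f (Sub x xA)).
  exists z => //; rewrite phiE -[LHS](SubK {x | x \in verts A} xA) -[Sub x xA]fK.
  by congr (val (g _)); apply: val_inj.
- move=> z z' zD z'D; rewrite !phiE => /val_inj/(can_inj gK)/(congr1 val).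
  exact: pt_inj.
move=> z z' zD z'D adj_zz'; rewrite !phiE.
set u := Sub (pt z) _; set v := Sub (pt z') _.
have : adj (f (g u)) (f (g v)) by rewrite !gK /= /sub_rel /= !imset_f.
by rewrite f_adj => /sub_adj_incl[].
Qed.

(** The factors are the [p]-part of [k], for its least prime divisor [p], and the cofactor, which
    exceeds 1 as [k] is not a prime power. Being coprime, they differ, and can be ordered. *)
Lemma coprime_factors (k : nat) : (3 <= k) -> ~ prime_power k ->
  exists a b, [/\ (1 < a), (a < b), coprime a b & k = (a * b)].
Proof.
move=> k_ge3 k_npp.
pose p := pdiv k; have p_pr : prime p by apply: pdiv_prime; apply: ltnW.
have k_gt0 : (0 < k) by lia.
have p_k : (0 < logn p k) by rewrite logn_gt0 mem_primes p_pr k_gt0 pdiv_dvd.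
have kE := partnC p k_gt0.
have co := coprime_partC p k k.
have a_gt1 : (1 < k`_p) by rewrite p_part -(exp1n (logn p k)) ltn_exp2r ?prime_gt1.
have b_gt1 : (1 < k`_p^').
  rewrite ltn_neqAle part_gt0 andbT; apply/eqP => b1; case: k_npp.
  by exists p, (logn p k); split=> //; rewrite -p_part -{1}kE -b1 muln1.
have : k`_p != k`_p^'.
  by apply/eqP => E; move: co; rewrite -E /coprime gcdnn; lia.
rewrite neq_ltn => /orP[ab|ba]; first by exists k`_p, k`_p^'.
by exists k`_p^', k`_p; rewrite coprime_sym mulnC.
Qed.

(** * The graph without perfect packings *)

Theorem theorem1p5 (k : nat) (k_ge3 : 3 <= k) (k_odd : odd k)
    (k_not_pp : ~ prime_power k) :
  exists (m : nat) (H : subgraph (torus k m)),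
    [/\ 1 <= m,
        induced H,
        #|verts H| %| k ^ m &
        forall n : nat, 1 <= n -> ~ has_perfect_packing H (torus k n)].
Proof.
have [a [b [a_gt1 lt_ab co_ab kE]]] := coprime_factors k_ge3 k_not_pp.
case: k k_ge3 k_odd k_not_pp kE => [|[|K]] // _ k_odd _ kE.
exists 3, (induced_subgraph (@plane_pt K @: young K a b : {set torus K.+2 3})).
split=> //; first exact: induced_subgraphP.
  (* Dimension 3 is where [a ^ 3 * b] divides [k ^ 3 = a ^ 3 * b ^ 3]. *)
  rewrite /= card_imset; last exact: plane_pt_inj.
  by rewrite (card_shape a_gt1 lt_ab kE) kE expnMn dvdn_mul // dvdn_exp.
move=> n _ /(@perfect_packing_dvdn _ (torus K.+2 n) (sublattice K a n) a).
have copies (A : subgraph (torus K.+2 n)) :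
    isomorphic A (induced_subgraph
      (@plane_pt K @: young K a b : {set torus K.+2 3})) ->
  (a %| #|verts A :&: (sublattice K a n : {set torus K.+2 n})|).
  case/(@isomorphic_imset _ (torus K.+2 3) (torus K.+2 n) _ _ _
    [ffun=> ord0] (@plane_pt_inj K)) => phi [<- phi_inj phi_adj].
  exact: dvdn_card_copy.
move=> /(_ copies); rewrite (card_sublattice n a_gt1 kE) => ab.
have /eqP : coprime a (b ^ n) by apply: coprimeXr.
by rewrite (gcdn_idPl ab) => a1; rewrite a1 in a_gt1.
Qed.
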